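(* Let $R$ be an associative ring with identity, $M$ a regular right $R$-module, $S=\mathrm{End}_R(M)$, and $m_1,m_2\in M$. Then $m_1\leq^{-}m_2$ if and only if there exist $f^2=f\in S$ and $a^2=a\in R$ such that $l_S(f)\subseteq l_S(m_1)$, $r_R(a)\subseteq r_R(m_1)$, $fm_1=fm_2$, and $m_1a=m_2a$.
   Context: Rings are associative with identity, and modules are unitary right modules. For a right $R$-module $M$, let $S=\mathrm{End}_R(M)$ (so $M$ is an $(S,R)$-bimodule) and $M^*=\mathrm{Hom}_R(M,R)$. For $m\in M$ and $\varphi\in M^*$, write $\varphi m:=\varphi(m)\in R$, and let $m\varphi\in S$ denote the endomorphism $x\mapsto m\,\varphi(x)$ of $M$. An element $m\in M$ is (Zelmanowitz) regular if $m=m\varphi m$, i.e. $m=m\,\varphi(m)$, for some $\varphi\in M^*$. The module $M$ is regular if every element of $M$ is regular. Minus order: for $m_1,m_2\in M$, $m_1\leq^{-}m_2$ means that there exists $\varphi\in M^*$ such that $m_1=m_1\varphi m_1$, $m_1\varphi=m_2\varphi$ (in $S$), and $\varphi m_1=\varphi m_2$ (in $R$). Annihilators: $l_S(m)=\{g\in S: gm=0\}$ and $r_R(m)=\{r\in R: mr=0\}$ for $m\in M$; $l_S(f)=\{g\in S: gf=0\}$ for $f\in S$; $r_R(a)=\{r\in R: ar=0\}$ for $a\in R$. *)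

(* Defs.v *)
From HB Require Import structures.
From mathcomp Require Import all_boot all_order all_algebra.
From mathcomp Require Import classical_sets.

Set Implicit Arguments.
Unset Strict Implicit.
Unset Printing Implicit Defensive.

Import GRing.Theory.
Local Open Scope ring_scope.
Local Open Scope classical_set_scope.

(* A right R-module is a left module over the converse ring R^c. Rings are     *)
(* pzRingType, so that the zero ring is allowed.                              *)
Notation rmodType R := (lmodType R^c).

Definition rscale (R : pzRingType) (M : rmodType R) (m : M) (r : R) : M :=
  (r : R^c) *: m.

Notation "m :* r" := (rscale m r) : ring_scope.

(* Elements of End_R(M) are compared with extensional equality =1, and their  *)
(* product is composition.                                                    *)
Notation endo M := {linear M -> M}.

(* R^c^o is R as a right module over itself, so that a dual element phi       *)
(* satisfies phi (m :* r) = phi m * r; see dual_rscale below.                 *)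
Notation dual R M := {linear M -> R^c^o}.

Section RightModule.
Variables (R : pzRingType) (M : rmodType R).
Implicit Types (m : M) (r a : R) (f g : endo M) (phi : dual R M).

Lemma rscaleM m r a : m :* (r * a) = (m :* r) :* a.
Proof. by rewrite /rscale scalerA. Qed.

Lemma rscaleDr m : {morph rscale m : r a / r + a}.
Proof. by move=> r a; rewrite /rscale scalerDl. Qed.

Lemma dual_rscale phi m r : phi (m :* r) = (phi m : R) * r.
Proof. by rewrite /rscale linearZ. Qed.

Definition dyad_fun m phi (x : M) : M := m :* phi x.

Fact dyad_fun_is_linear m phi : linear (dyad_fun m phi).
Proof.
move=> r x y; rewrite /dyad_fun linearP rscaleDr; congr (_ + _).
exact: rscaleM.
Qed.

HB.instance Definition _ m phi :=
  GRing.isLinear.Build R^c M M *:%R (dyad_fun m phi) (dyad_fun_is_linear m phi).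

(* The endomorphism written m phi when M is viewed as an (S,R)-bimodule.      *)
Definition dyad m phi : endo M := dyad_fun m phi.

Definition regular_elt m := exists phi : dual R M, m = m :* phi m.

Definition minus_le m1 m2 :=
  exists phi : dual R M,
    [/\ m1 = m1 :* phi m1, dyad m1 phi =1 dyad m2 phi & phi m1 = phi m2].

Definition lann_elt m : set (endo M) := [set g : endo M | g m = 0].

Definition lann_endo f : set (endo M) := [set g : endo M | g \o f =1 \0].

Definition rann_elt m : set R := [set r : R | m :* r = 0].

End RightModule.

Definition regular_module (R : pzRingType) (M : rmodType R) :=
  forall m : M, regular_elt m.

Definition rann_ring (R : pzRingType) (a : R) : set R := [set r : R | a * r = 0].

(* Main.v *)
(* In one direction take f = m1 phi and a = phi m1. Conversely, applying the   *)
(* annihilator inclusions to 1 - f and 1 - a gives m1 = f m1 = f m2 and        *)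
(* m1 = m1 a = m2 a; if m1 = m1 psi m1, then phi = a psi f witnesses           *)
(* m1 <=^- m2.                                                                 *)

Require Import Defs.
From HB Require Import structures.
From mathcomp Require Import all_boot all_order all_algebra.
From mathcomp Require Import classical_sets.

Set Implicit Arguments.
Unset Strict Implicit.
Unset Printing Implicit Defensive.

Import GRing.Theory.
Local Open Scope ring_scope.
Local Open Scope classical_set_scope.

(** For idempotent [f] and [a], the annihilator inclusions amount to [f m1 = m1] and [m1 :* a = m1]
    ([lann_endo_fixed], [rann_ring_fixed]). Regularity of [m1] then supplies a functional that [f]
    and [a] correct on either side. *)

Definition dual_lmul_fun (R : pzRingType) (M : rmodType R) (a : R)
  (phi : dual R M) (x : M) : R^c^o := a * (phi x : R).

Fact dual_lmul_fun_is_linear (R : pzRingType) (M : rmodType R) (a : R)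
  (phi : dual R M) : linear (dual_lmul_fun a phi).
Proof.
move=> r x y; rewrite /dual_lmul_fun linearP /= mulrDr; congr (_ + _).
(* Scaling in [R^c^o] is right multiplication in [R], so linearity is associativity. *)
exact: (mulrA a (phi x : R) (r : R)).
Qed.

HB.instance Definition _ (R : pzRingType) (M : rmodType R) (a : R)
    (phi : dual R M) :=
  GRing.isLinear.Build R^c M R^c^o *:%R (dual_lmul_fun a phi)
    (dual_lmul_fun_is_linear a phi).

Definition dual_lmul (R : pzRingType) (M : rmodType R) (a : R)
  (phi : dual R M) : dual R M := dual_lmul_fun a phi.

(** Idempotence puts [idfun \- f] in the left annihilator of [f], so it kills [m]. *)
Lemma lann_endo_fixed (R : pzRingType) (M : rmodType R) (f : endo M) (m : M) :
  f \o f =1 f -> lann_endo f `<=` lann_elt m -> f m = m.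
Proof.
move=> ff /(_ (idfun \- f : endo M)) fm; apply/esym/eqP; rewrite -subr_eq0.
by apply/eqP/fm => x /=; rewrite -[f (f x)]/((f \o f) x) ff subrr.
Qed.

Lemma rann_ring_fixed (R : pzRingType) (M : rmodType R) (a : R) (m : M) :
  a ^+ 2 = a -> rann_ring a `<=` rann_elt m -> m :* a = m.
Proof.
move=> aa /(_ (1 - a)) am; apply/esym/eqP; rewrite -subr_eq0; apply/eqP.
rewrite -[m in m - _](scale1r (m : M)) -scalerBl; apply: am.
by rewrite /rann_ring /= mulrBr mulr1 -expr2 aa subrr.
Qed.

Theorem theorem3p2 (R : pzRingType) (M : rmodType R)
    (hM : regular_module M) (m1 m2 : M) :
  minus_le m1 m2 <->
  exists (f : endo M) (a : R),
    (f \o f =1 f /\ a ^+ 2 = a) /\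
    [/\ lann_endo f `<=` lann_elt m1,
        rann_ring a `<=` rann_elt m1,
        f m1 = f m2 &
        m1 :* a = m2 :* a].
Proof.
split=> [[phi [m1E m12 phi12]]|[f [a [[ff aa] [fm am f12 a12]]]]].
  exists (dyad m1 phi), (phi m1); split.
    split=> [x|]; first by rewrite /= /dyad_fun dual_rscale rscaleM -m1E.
    by rewrite expr2 -dual_rscale -m1E.
  split=> [g gf|r ar||].
  (* Here [m1 = dyad m1 phi m1], so [g] kills [m1] once it kills the dyad. *)
  - by rewrite /lann_elt /= {1}m1E; apply: gf.
  - by rewrite /rann_elt /= {1}m1E -rscaleM ar /rscale scale0r.
  - by rewrite /= /dyad_fun phi12.
  - exact: m12 m1.
have fm1 := lann_endo_fixed ff fm.
have m1a := rann_ring_fixed aa am.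
have [psi m1E] := hM m1.
(* The factor [a] turns [a12] into equality of the dyads; the factor [f] turns [f12] into equality
   of the values at [m1] and [m2]. *)
exists (dual_lmul a (psi \o f : dual R M)); split=> [|x|] /=.
- by rewrite /dual_lmul_fun /= rscaleM m1a fm1.
- by rewrite /dyad_fun /= /dual_lmul_fun !rscaleM a12.
- by rewrite /dual_lmul_fun /= f12.
Qed.
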